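(* Let $m,n\in\mathbb{N}$ and $c,d>0$, let $r,s\in\mathbb{R}^k$ be vectors and let $A,B$ be invertible $k\times k$ matrices such that $AB^{-1}$ is diagonalisable. Assume that two functions $f,g$ on $\mathbb{R}^k$ satisfy $$|f(x)|\lesssim\left(|A(x+r)|^2+c^2\right)^{-m}\qquad\text{and}\qquad |g(x)|\lesssim\left(|B(x+s)|^2+d^2\right)^{-n}.$$ Then, if $m,n>\lceil\frac k2\rceil$, the convolution of $f$ and $g$ satisfies $$|[f*g](t)|\lesssim\frac1{|\det B|}\left(\frac{\|BA^{-1}\|^{k}}{\left(|B(r+s+t)|^2+d^2+\|BA^{-1}\|^2c^2\right)^n}\frac1{c^{2m-k-1}}+\frac{\|BA^{-1}\|^{2m}}{\left(|B(r+s+t)|^2+d^2+\|BA^{-1}\|^2c^2\right)^m}\frac1{d^{2n-k-1}}\right),$$ and, in a dual way, the same estimate holds after concurrently switching $r\leftrightarrow s$, $A\leftrightarrow B$, $c\leftrightarrow d$ and $m\leftrightarrow n$, i.e. one can choose the minimum of the two bounds. Specialising to $A=B=\mathbb{I}$ and $r=s=0$, $$|[f*g](t)|\lesssim\frac1{\left(|t|^2+c^2+d^2\right)^n}\frac1{c^{2m-k-1}}+\frac1{\left(|t|^2+c^2+d^2\right)^m}\frac1{d^{2n-k-1}}.$$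
   Context: $\mathbb{N}$ is the set of natural numbers without zero, and $k\in\mathbb{N}$ is the dimension. $[f*g](t)=\int_{\mathbb{R}^k}f(t-x)g(x)\,dx$ for $t\in\mathbb{R}^k$; $|\cdot|$ is the Euclidean norm on $\mathbb{R}^k$, $\|\cdot\|$ the matrix norm induced by it, $\mathbb{I}$ the identity matrix. $X(y)\lesssim Y(y)$ means that there is a constant $C>0$, independent of $y$, with $X(y)\le C\,Y(y)$. *)

(* Defs.v *)
From HB Require Import structures.
From mathcomp Require Import all_boot all_order all_algebra.
From mathcomp Require Import complex.
From mathcomp Require Import all_classical all_reals all_analysis.

Set Implicit Arguments.
Unset Strict Implicit.
Unset Printing Implicit Defensive.

Import Order.TTheory GRing.Theory Num.Theory.
Import numFieldNormedType.Exports.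

Local Open Scope classical_set_scope.
Local Open Scope ring_scope.

Definition tcons {T : Type} {k : nat} (p : T * k.-tuple T) : k.+1.-tuple T :=
  [tuple of p.1 :: p.2].

Lemma measurable_tcons {d : measure_display} {T : measurableType d} {k : nat} :
  measurable_fun [set: T * k.-tuple T] (@tcons T k).
Proof. by apply: measurable_cons; [exact: measurable_fst | exact: measurable_snd]. Qed.

Section lebesgue_succ.
Context {R : realType} {k : nat}.
Variable mu : {sigma_finite_measure set (k.-tuple (measurableTypeR R)) -> \bar R}.

Definition lebesgue_succ : set (k.+1.-tuple (measurableTypeR R)) -> \bar R :=
  pushforward (@lebesgue_measure R \x mu)%E tcons.

HB.instance Definition _ := Measure.copy lebesgue_succ
  (measure_function_pushforward__canonical__measure_function_Measure
     (@lebesgue_measure R \x mu)%E measurable_tcons).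

Let lebesgue_succ_sigma_finite : sigma_finite setT lebesgue_succ.
Proof.
have /sigma_finiteP[F [TF ndF Foo]] := sigma_finiteT (@lebesgue_measure R).
have /sigma_finiteP[G [TG ndG Goo]] := sigma_finiteT mu.
pose h (t : k.+1.-tuple (measurableTypeR R)) := (thead t, [tuple of behead t]).
have mh : measurable_fun setT h.
  by apply: measurable_fun_pair; [exact: measurable_tnth | exact: measurable_behead].
have tconsK : h \o tcons = id.
  by apply/funext => -[x t]; rewrite /h /= theadE; congr pair; exact/val_inj.
exists (fun i => h @^-1` (F i `*` G i)).
  apply/esym; rewrite -subTset => t _.
  have [i _ Fi] : (\bigcup_i F i) (h t).1 by rewrite -TF.
  have [j _ Gj] : (\bigcup_i G i) (h t).2 by rewrite -TG.
  exists (maxn i j) => //; split.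
    by move: Fi; exact/subsetPset/ndF/leq_maxl.
  by move: Gj; exact/subsetPset/ndG/leq_maxr.
move=> i; have [mF F_oo] := Foo i; have [mG G_oo] := Goo i; split.
  by rewrite -[X in measurable X]setTI; apply: mh => //; exact: measurableX.
rewrite /lebesgue_succ /pushforward -comp_preimage tconsK preimage_id.
by rewrite product_measure1E// lte_mul_pinfty// ge0_fin_numE.
Qed.

HB.instance Definition _ :=
  Measure_isSigmaFinite.Build _ _ _ lebesgue_succ lebesgue_succ_sigma_finite.

End lebesgue_succ.

Fixpoint lebesgue_tuple (R : realType) (k : nat) :
    {sigma_finite_measure set (k.-tuple (measurableTypeR R)) -> \bar R} :=
  match k with
  | 0 => \d_([tuple] : 0.-tuple (measurableTypeR R))
  | k'.+1 => lebesgue_succ (lebesgue_tuple R k')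
  end.

Definition euclidean_norm {R : realType} {k : nat} (x : 'cV[R]_k) : R :=
  Num.sqrt (\sum_i x i 0 ^+ 2).

Definition opnorm {R : realType} {k : nat} (M : 'M[R]_k) : R :=
  sup [set euclidean_norm (M *m x) | x in [set x : 'cV[R]_k | euclidean_norm x <= 1]].

Definition integral_Rk {R : realType} {k : nat} (h : 'cV[R]_k -> R) : R :=
  \int[lebesgue_tuple R k]_x h (\col_i tnth x i).

(* Total: when Re h and Im h agree almost everywhere with integrable Borel
   functions this is the Lebesgue integral of h; for any other h it is the
   conventional value of the total integral. *)
Definition cintegral_Rk {R : realType} {k : nat} (h : 'cV[R]_k -> R[i]) : R[i] :=
  Complex (integral_Rk (fun x => complex.Re (h x))) (integral_Rk (fun x => complex.Im (h x))).

Definition convolution {R : realType} {k : nat} (f g : 'cV[R]_k -> R[i]) (t : 'cV[R]_k) : R[i] :=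
  cintegral_Rk (fun x => f (t - x) * g x).

Definition cabs {R : realType} (z : R[i]) : R := ComplexField.Normc.normc z.

(* A real matrix diagonalisable over the reals is a fortiori diagonalisable in
   this sense; rotations, for instance, are covered as well. *)
Definition cdiagonalizable {R : realType} {k : nat} (M : 'M[R]_k) : Prop :=
  diagonalizable (map_mx (real_complex R) M).

(* When uphalf k < m and uphalf k < n, the truncated differences are genuine:
   k + 2 <= 2 * m and k + 2 <= 2 * n. *)
Definition conv_bound {R : realType} {k : nat} (m n : nat) (c d : R)
    (r s : 'cV[R]_k) (A B : 'M[R]_k) (t : 'cV[R]_k) : R :=
  let K := opnorm (B *m invmx A) in
  let N := euclidean_norm (B *m (r + s + t)) ^+ 2 + d ^+ 2 + K ^+ 2 * c ^+ 2 in
  `|\det B|^-1 *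
    (K ^+ k / N ^+ n * (c ^+ (2 * m - k - 1))^-1 +
     K ^+ (2 * m) / N ^+ m * (d ^+ (2 * n - k - 1))^-1).

(* Main.v *)
Require Import Defs.
From mathcomp Require Import all_boot all_order all_algebra.
From mathcomp Require Import complex.
From mathcomp Require Import all_classical all_reals all_analysis.
From mathcomp Require Import measurable_realfun ring lra zify.

Set Implicit Arguments.
Unset Strict Implicit.
Unset Printing Implicit Defensive.

Import Order.TTheory GRing.Theory Num.Theory.
Import numFieldNormedType.Exports.
Local Open Scope classical_set_scope.
Local Open Scope ring_scope.

(* Let [a = t + r], [b = - s], [P = |A (x - a)|^2 + c^2] and
   [Q = |B (x - b)|^2 + d^2], so that the integrand of the convolution is
   bounded by [P^-m Q^-n].  With [K = |B A^-1|] the parallelogram inequality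
   gives [N = |B (a - b)|^2 + d^2 + K^2 c^2 <= 2 K^2 P + 2 Q], hence at each
   point one of [K^2 P], [Q] is at least [N / 4]; that factor is pulled out of
   the integral and the remaining one is integrated over all of R^k.  The
   integral of [(|B x + b|^2 + d^2)^(-p/2)] is bounded without a change of
   variables, by induction on the dimension: completing the square in the first
   variable reduces its integration to that of [1 / (1 + x^2)], lowers [p] by
   one, and splits off a factor of the Gram determinant [det (B^T B)].  This
   works for rectangular [B], which the induction needs.  Passing from
   [c^-(2m-k)] to [c^-(2m-k-1)] costs the factor [1 / c0]. *)

(** * One-dimensional integrals *)

Lemma integral_oneDsqrV (R : realType) :
  (\int[@lebesgue_measure R]_x (oneDsqr x)^-1%:E = pi%:E)%E.
Proof.
rewrite (@ge0_symfun_integralT R (fun x => (oneDsqr x)^-1)).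
- by rewrite -set_itvcy integral0y_oneDsqr -EFinM mulrC divfK.
- by move=> x; rewrite invr_ge0.
- exact: continuous_oneDsqrV.
- by move=> x; rewrite /= /oneDsqr sqrrN.
Qed.

Lemma integral_oneDsqrV_affine (R : realType) (a l : R) : 0 < a ->
  (\int[@lebesgue_measure R]_x (a / oneDsqr ((x + l) * a))%:E = pi%:E)%E.
Proof.
move=> a0; pose F (x : R^o) : R^o := (x + l) * a.
have F'E : F^`()%classic = cst a.
  apply/funext => x; rewrite /F derive1E deriveM// deriveD// derive_cst scaler0.
  by rewrite add0r derive_id derive_cst addr0 scaler1.
rewrite -integral_oneDsqrV.
rewrite (@increasing_ge0_integration_by_substitutionT R F (fun x => (oneDsqr x)^-1)).
- by apply: eq_integral => x _; rewrite F'E /= mulrC.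
- by move=> x y xy; rewrite /F ltr_pM2r// ltrD2r.
- by rewrite F'E => ?; exact: cvg_cst.
- by rewrite F'E; exact: is_cvg_cst.
- by rewrite F'E; exact: is_cvg_cst.
- by move=> x; exact: derivableM.
- by apply/gt0_cvgMlNy => //; exact: cvg_addrr_Ny.
- by apply/gt0_cvgMly => //; exact: cvg_addrr.
- exact: continuous_oneDsqrV.
- by move=> x; rewrite invr_ge0.
Qed.

Lemma measurable_sqrtDV d (T : measurableType d) (R : realType) (f : T -> R)
    (e : R) (p : nat) : 0 < e -> (forall x, 0 <= f x) ->
  measurable_fun setT f ->
  measurable_fun setT (fun x => Num.sqrt (f x + e ^+ 2) ^- p).
Proof.
move=> e0 f0 mf.
(* Replacing [f x] by its absolute value makes the outer map continuous on all of R, since its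
   radicand is then everywhere positive. *)
have -> : (fun x => Num.sqrt (f x + e ^+ 2) ^- p) =
    (fun y : R => Num.sqrt (`|y| + e ^+ 2) ^- p) \o f.
  by apply/funext => x /=; rewrite ger0_norm.
apply: measurableT_comp => //; apply: continuous_measurable_fun => y.
have h : Num.sqrt (`|y| + e ^+ 2) != 0.
  by rewrite gt_eqF// sqrtr_gt0 ltr_wpDl// exprn_gt0.
apply: cvgV; first by rewrite expf_neq0.
apply: (@continuous_comp _ _ _ (fun y : R => Num.sqrt (`|y| + e ^+ 2))
  (fun z => z ^+ p)); last exact: exprn_continuous.
apply: (@continuous_comp _ _ _ (fun y : R => `|y| + e ^+ 2) Num.sqrt);
  last exact: sqrt_continuous.
by apply: cvgD; [exact: norm_continuous|exact: cvg_cst].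
Qed.

(** The square root [S] is at least [e], so [p] of its [p.+2] inverse powers are bounded by
    [e ^- p]. The remaining [S ^- 2] is a rescaled [1 / (1 + x^2)] with integral [pi / (a * e)], so
    one power is lost in total. *)
Lemma integral_sqrt_quadV_le (R : realType) (a e l : R) (p : nat) :
  0 < a -> 0 < e ->
  (\int[@lebesgue_measure R]_x
     (Num.sqrt (a ^+ 2 * (x + l) ^+ 2 + e ^+ 2) ^- p.+2)%:E <=
   (pi / a * e ^- p.+1)%:E)%E.
Proof.
move=> a0 e0; have ae0 : 0 < a / e by rewrite divr_gt0.
have -> : ((pi / a * e ^- p.+1)%:E =
    (a^-1 * e ^- p.+1)%:E * \int[@lebesgue_measure R]_x
       ((a / e) / oneDsqr ((x + l) * (a / e)))%:E)%E.
  by rewrite integral_oneDsqrV_affine// -EFinM; congr EFin; ring.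
have mq : measurable_fun setT (fun x : R => a ^+ 2 * (x + l) ^+ 2).
  by apply: measurable_funM => //; apply: measurable_funX; exact: measurable_funD.
have c0 : 0 <= a^-1 * e ^- p.+1.
  by rewrite mulr_ge0// invr_ge0 ?exprn_ge0 ?ltW.
have h0 x : 0 <= a / e / oneDsqr ((x + l) * (a / e)).
  by rewrite divr_ge0// ?ltW// (lt_le_trans ltr01)// oneDsqr_ge1.
have mh : measurable_fun setT (fun x : R => a / e / oneDsqr ((x + l) * (a / e))).
  apply: measurable_funM => //.
  change (measurable_fun setT
    ((fun y : R => (oneDsqr y)^-1) \o (fun x : R => (x + l) * (a / e)))).
  apply: measurableT_comp.
    by apply: continuous_measurable_fun; exact: continuous_oneDsqrV.
  by apply: measurable_funM => //; exact: measurable_funD.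
rewrite -ge0_integralZl//; first last.
- by move=> x _; rewrite lee_fin.
- exact/measurable_EFinP.
apply: ge0_le_integral => //.
- apply/measurable_EFinP; apply: measurable_sqrtDV => // x.
  by rewrite mulr_ge0// sqr_ge0.
- by apply/measurable_EFinP; exact: measurable_funM.
move=> x _; rewrite -EFinM lee_fin.
set y := x + l; set S := Num.sqrt _.
have S2 : S ^+ 2 = e ^+ 2 * oneDsqr (y * (a / e)).
  rewrite sqr_sqrtr ?(addr_ge0 (mulr_ge0 (sqr_ge0 _) (sqr_ge0 _)) (sqr_ge0 _))//.
  rewrite /oneDsqr.
  by field; rewrite gt_eqF.
have eS : e <= S.
  have : e ^+ 2 <= S ^+ 2 by rewrite S2 ler_peMr ?sqr_ge0 ?oneDsqr_ge1.
  by rewrite ler_pXn2r// nnegrE ?sqrtr_ge0 ?ltW.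
have S0 : 0 < S := lt_le_trans e0 eS.
have -> : a^-1 * e ^- p.+1 * (a / e / oneDsqr (y * (a / e))) = e ^- p * S ^- 2.
  rewrite S2 exprS; field.
  by rewrite expf_neq0 ?gt_eqF// (lt_le_trans ltr01)// oneDsqr_ge1.
rewrite -addn2 exprD invfM ler_pM2r ?invr_gt0 ?exprn_gt0//.
by rewrite lef_pV2 ?posrE ?exprn_gt0// lerXn2r// ?nnegrE ltW.
Qed.

(** * The Euclidean norm and completing the square *)

Section EuclideanNorm.
Context {R : realType}.

Lemma euclidean_normE k (x : 'cV[R]_k) :
  euclidean_norm x ^+ 2 = \sum_i x i 0 ^+ 2.
Proof. by rewrite sqr_sqrtr// sumr_ge0// => i _; rewrite sqr_ge0. Qed.

Lemma euclidean_norm_dotE k (x : 'cV[R]_k) :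
  euclidean_norm x ^+ 2 = (x^T *m x) 0 0.
Proof. by rewrite euclidean_normE mxE; apply: eq_bigr => i _; rewrite mxE. Qed.

Lemma euclidean_norm_ge0 k (x : 'cV[R]_k) : 0 <= euclidean_norm x.
Proof. exact: sqrtr_ge0. Qed.

Lemma euclidean_norm_eq0 k (x : 'cV[R]_k) : (euclidean_norm x == 0) = (x == 0).
Proof.
apply/idP/eqP => [|->]; last first.
  by rewrite /euclidean_norm big1 ?sqrtr0// => i _; rewrite mxE expr0n.
rewrite -sqrf_eq0 euclidean_normE psumr_eq0; last by move=> i _; exact: sqr_ge0.
move=> /allP x0; apply/colP => i; rewrite mxE.
by have /(_ (mem_index_enum i)) := x0 i; rewrite sqrf_eq0 => /eqP.
Qed.

Lemma euclidean_normZ k (a : R) (x : 'cV[R]_k) :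
  euclidean_norm (a *: x) = `|a| * euclidean_norm x.
Proof.
rewrite /euclidean_norm -sqrtr_sqr -sqrtrM ?sqr_ge0// mulr_sumr.
by congr Num.sqrt; apply: eq_bigr => i _; rewrite mxE exprMn.
Qed.

Lemma euclidean_normN k (x : 'cV[R]_k) : euclidean_norm (- x) = euclidean_norm x.
Proof. by rewrite -scaleN1r euclidean_normZ normrN1 mul1r. Qed.

Lemma euclidean_normD_sqr_le k (x y : 'cV[R]_k) :
  euclidean_norm (x + y) ^+ 2 <= 2 * euclidean_norm x ^+ 2 + 2 * euclidean_norm y ^+ 2.
Proof.
rewrite !euclidean_normE !mulr_sumr -big_split /= ler_sum// => i _.
by rewrite mxE -subr_ge0 (_ : _ - _ = (x i 0 - y i 0) ^+ 2) ?sqr_ge0//; ring.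
Qed.

Lemma euclidean_norm_pythagoras k (x y : 'cV[R]_k) : x^T *m y = 0 ->
  euclidean_norm (x + y) ^+ 2 = euclidean_norm x ^+ 2 + euclidean_norm y ^+ 2.
Proof.
move=> xy; have yx : y^T *m x = 0 by rewrite -[LHS]trmxK trmx_mul trmxK xy trmx0.
by rewrite !euclidean_norm_dotE [(x + y)^T]linearD mulmxDl !mulmxDr xy yx addr0 add0r mxE.
Qed.

(* Orthogonal projection off the first column of [W] eliminates the first
   variable and factors its squared norm out of the Gram determinant. *)
Lemma complete_square l k (W : 'M[R]_(l, 1 + k)) (b : 'cV[R]_l) :
  0 < \det (W^T *m W) ->
  exists (a c : R) (w : 'rV[R]_k) (W1 : 'M[R]_(l, k)) (b1 : 'cV[R]_l),
  [/\ 0 < a, \det (W^T *m W) = a ^+ 2 * \det (W1^T *m W1) &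
    forall (x0 : R) (x : 'cV[R]_k),
      euclidean_norm (W *m col_mx x0%:M x + b) ^+ 2 =
      a ^+ 2 * (x0 + ((w *m x) 0 0 + c)) ^+ 2 + euclidean_norm (W1 *m x + b1) ^+ 2].
Proof.
move=> W0; set v := lsubmx W; set B := rsubmx W.
have WE : W = row_mx v B by rewrite hsubmxK.
set a := euclidean_norm v.
have a0 : 0 < a.
  rewrite lt_neqAle euclidean_norm_ge0 andbT eq_sym euclidean_norm_eq0.
  (* A vanishing first column would make the Gram determinant zero. *)
  apply/eqP => v0; move: W0; rewrite WE v0 tr_row_mx mul_col_row trmx0 !mul0mx.
  by rewrite mulmx0 det_ublock det_mx11 mxE mul0r ltxx.
have a20 : a ^+ 2 != 0 by rewrite expf_neq0// gt_eqF.
have vv : v^T *m v = (a ^+ 2)%:M by rewrite euclidean_norm_dotE; exact: mx11_scalar.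
(* [v *m proj m M] is the orthogonal projection of the columns of [M] onto the line spanned by
   [v]. *)
pose proj m (M : 'M[R]_(l, m)) := a ^- 2 *: (v^T *m M).
have projP m (M : 'M[R]_(l, m)) : v^T *m (M - v *m proj m M) = 0.
  by rewrite mulmxBr mulmxA vv mul_scalar_mx scalerA mulfV// scale1r subrr.
exists a, (proj _ b 0 0), (proj _ B), (B - v *m proj _ B), (b - v *m proj _ b).
split => //.
- set B1 := B - _.
  have vB1 : v^T *m B1 = 0 by exact: projP.
  have B1v : B1^T *m v = 0 by rewrite -[LHS]trmxK trmx_mul trmxK vB1 trmx0.
  (* [E] is unipotent, and the Gram matrix of [row_mx v B1] is block diagonal with blocks [a ^+ 2]
     and [B1^T *m B1]. *)
  set E := block_mx 1%:M (proj _ B) 0 1%:M : 'M[R]_(1 + k).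
  have -> : W = row_mx v B1 *m E.
    by rewrite WE mul_row_block !mulmx1 mulmx0 addr0 addrC subrK.
  rewrite trmx_mul -mulmxA [_ *m (_ *m E)]mulmxA tr_row_mx mul_col_row vv vB1 B1v.
  rewrite !det_mulmx det_tr det_ublock !det1 det_ublock det_scalar expr1; ring.
- move=> x0 x.
  set y := (x0 + _); set z := _ + (b - _).
  have -> : W *m col_mx x0%:M x + b = y *: v + z.
    have vM (M : 'M[R]_1) : v *m M = M 0 0 *: v.
      by rewrite {1}[M]mx11_scalar mul_mx_scalar.
    rewrite WE mul_row_col /z /y mulmxBl -mulmxA !vM mxE eqxx mulr1n !scalerDl.
    by apply/colP => i; rewrite !mxE; ring.
  rewrite euclidean_norm_pythagoras ?euclidean_normZ -/a.
    by rewrite exprMn real_normK ?num_real// mulrC.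
  by rewrite linearZ /= -scalemxAl /z mulmxDr mulmxA projP mul0mx projP addr0 scaler0.
Qed.

End EuclideanNorm.

(** * Integrals of inverse powers of quadratic weights over R^k *)

Section AffineWeight.
Context {R : realType}.

Definition tuple_col k (x : k.-tuple R) : 'cV[R]_k := \col_i tnth x i.

(** The exponent counts powers of the square root rather than of the quadratic form, so that
    integrating out one variable can lower it by exactly one. *)
Definition affine_weight l k (W : 'M[R]_(l, k)) (b : 'cV[R]_l) (d : R) (p : nat)
    (x : k.-tuple (measurableTypeR R)) : R :=
  Num.sqrt (euclidean_norm (W *m tuple_col x + b) ^+ 2 + d ^+ 2) ^- p.

Lemma tuple_col_tcons k (x0 : R) (x : k.-tuple R) :
  tuple_col (tcons (x0, x)) = col_mx x0%:M (tuple_col x) :> 'cV_(1 + k).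
Proof.
apply/colP => i; rewrite mxE; case: (split_ordP i) => j ->.
  by rewrite col_mxEu ord1 mxE eqxx mulr1n (tnth_nth 0).
by rewrite col_mxEd mxE !(tnth_nth 0).
Qed.

Lemma affine_weight_ge0 l k (W : 'M[R]_(l, k)) b d p x :
  0 <= affine_weight W b d p x.
Proof. by rewrite invr_ge0 exprn_ge0// sqrtr_ge0. Qed.

Lemma measurable_affine_weight l k (W : 'M[R]_(l, k)) b d p : 0 < d ->
  measurable_fun setT (affine_weight W b d p).
Proof.
move=> d0; apply: measurable_sqrtDV => //; first by move=> x; exact: sqr_ge0.
under eq_fun do rewrite euclidean_normE.
apply: measurable_sum => i; apply: measurable_funX.
under eq_fun do rewrite !mxE.
apply: measurable_funD => //; apply: measurable_sum => j.
under eq_fun do rewrite mxE.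
by apply: measurable_funM => //; exact: measurable_tnth.
Qed.

(** Induction on [k] with [l] fixed, by Tonelli. In dimension 0 the measure is a Dirac mass and the
    weight is at most [d ^- p]; each further variable contributes [pi / a] and lowers [p] and [k]
    together, so the power of [d] is preserved. *)
Lemma integral_affine_weight_le l k p (W : 'M[R]_(l, k)) (b : 'cV[R]_l) (d : R) :
  0 < d -> (k < p)%N -> 0 < \det (W^T *m W) ->
  (\int[lebesgue_tuple R k]_x (affine_weight W b d p x)%:E <=
   (pi ^+ k / Num.sqrt (\det (W^T *m W)) * d ^- (p - k))%:E)%E.
Proof.
elim: k p W b => [|k IH] p W b d0 kp W0.
  rewrite integral_dirac//; last by apply/measurable_EFinP; exact: measurable_affine_weight.
  rewrite diracE mem_set// mul1e lee_fin det_mx00 sqrtr1 expr0 divr1 mul1r subn0.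
  have Sd : d <= Num.sqrt (euclidean_norm (W *m tuple_col [tuple] + b) ^+ 2 + d ^+ 2).
    by rewrite -{1}(gtr0_norm d0) -sqrtr_sqr ler_wsqrtr// lerDr sqr_ge0.
  have S0 := lt_le_trans d0 Sd.
  by rewrite lef_pV2 ?posrE ?exprn_gt0// lerXn2r// ?nnegrE ltW.
case: p kp => // -[//|p] kp; rewrite ltnS in kp.
have [a [c [w [W1 [b1 [a0 detW quadE]]]]]] := @complete_square R l k W b W0.
have W10 : 0 < \det (W1^T *m W1) by rewrite -(pmulr_rgt0 _ (exprn_gt0 2 a0)) -detW.
rewrite ge0_integral_pushforward//; first last.
- by move=> x _; rewrite lee_fin affine_weight_ge0.
- by apply/measurable_EFinP; exact: measurable_affine_weight.
- exact: measurable_tcons.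
rewrite preimage_setT fubini_tonelli2; first last.
- by move=> x; rewrite lee_fin affine_weight_ge0.
- apply/measurable_EFinP; apply: measurableT_comp; last exact: measurable_tcons.
  exact: measurable_affine_weight.
apply: (@le_trans _ _ (\int[lebesgue_tuple R k]_x
   ((pi / a)%:E * (affine_weight W1 b1 d p.+1 x)%:E))%E).
  apply: ge0_le_integral => //.
  - by move=> x _; apply: integral_ge0 => y _; rewrite lee_fin affine_weight_ge0.
  - apply: measurable_fun_fubini_tonelli_G.
      apply/measurable_EFinP; apply: measurableT_comp; last exact: measurable_tcons.
      exact: measurable_affine_weight.
    by move=> x; rewrite lee_fin affine_weight_ge0.
  - apply/measurable_EFinP; apply: measurable_funM => //.
    exact: measurable_affine_weight.
  move=> x _; rewrite -EFinM /fubini_G.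
  (* [e] is free of the first variable, so the one-dimensional bound applies with [e] as its
     constant; the resulting [e ^- p.+1] is the weight of [W1]. *)
  set e := Num.sqrt (euclidean_norm (W1 *m tuple_col x + b1) ^+ 2 + d ^+ 2).
  have E0 : 0 < euclidean_norm (W1 *m tuple_col x + b1) ^+ 2 + d ^+ 2.
    by rewrite ltr_wpDl ?sqr_ge0// exprn_gt0.
  have e0 : 0 < e by rewrite sqrtr_gt0.
  under eq_integral => x0 _.
    rewrite /= /affine_weight tuple_col_tcons quadE -addrA.
    rewrite -[X in _ + X](sqr_sqrtr (ltW E0)) -/e.
    over.
  exact: integral_sqrt_quadV_le.
rewrite ge0_integralZl//; first last.
- by rewrite lee_fin divr_ge0 ?pi_ge0 ?ltW.
- by move=> x _; rewrite lee_fin affine_weight_ge0.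
- by apply/measurable_EFinP; exact: measurable_affine_weight.
apply: (@le_trans _ _ ((pi / a)%:E *
   (pi ^+ k / Num.sqrt (\det (W1^T *m W1)) * d ^- (p.+1 - k))%:E)%E).
  by rewrite lee_wpmul2l ?lee_fin ?divr_ge0 ?pi_ge0 ?(ltW a0)//; exact: IH.
rewrite -EFinM lee_fin detW sqrtrM ?sqr_ge0// sqrtr_sqr gtr0_norm// subSS.
by rewrite exprS invfM le_eqVlt; apply/orP; left; apply/eqP; ring.
Qed.

End AffineWeight.

Lemma integral_square_affine_weight_le (R : realType) k p (W : 'M[R]_k)
    (b : 'cV[R]_k) (d : R) :
  0 < d -> (k < p)%N -> W \in unitmx ->
  (\int[lebesgue_tuple R k]_x (affine_weight W b d p x)%:E <=
   (pi ^+ k / `|\det W| * d ^- (p - k))%:E)%E.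
Proof.
move=> d0 kp Wu.
have detWE : \det (W^T *m W) = \det W ^+ 2 by rewrite det_mulmx det_tr.
rewrite -sqrtr_sqr -detWE; apply: integral_affine_weight_le => //.
by rewrite detWE exprn_even_gt0//= -unitfE -unitmxE.
Qed.

Lemma affine_weight_double (R : realType) l k (W : 'M[R]_(l, k)) (b : 'cV[R]_l)
    (d : R) (m : nat) (x : k.-tuple R) :
  affine_weight W b d (2 * m) x =
  (euclidean_norm (W *m tuple_col x + b) ^+ 2 + d ^+ 2) ^- m.
Proof. by rewrite /affine_weight exprM sqr_sqrtr// addr_ge0 ?sqr_ge0. Qed.

(** * Domination of integrals of arbitrary real functions *)

(* For a non-measurable [f] the library integral is a supremum over simple
   functions below [f], hence still monotone. *)
Lemma ge0_le_integral_nonmeasurable d (T : measurableType d) (R : realType)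
    (mu : {measure set T -> \bar R}) (f g : T -> \bar R) :
  (forall x, 0 <= f x)%E -> (forall x, f x <= g x)%E ->
  (\int[mu]_x f x <= \int[mu]_x g x)%E.
Proof.
move=> f0 fg; have g0 x : (0 <= g x)%E by exact: le_trans (f0 x) (fg x).
rewrite !ge0_integralTE//; apply: ereal_sup_le => _ [h /= hf <-].
by exists h => //= x; exact: le_trans (hf x) (fg x).
Qed.

(** The positive and negative parts of [f] both lie below [g], so monotonicity alone puts their
    integrals in [[0, M]], and the difference of two such numbers has absolute value at most [M]. *)
Lemma normr_Rintegral_le d (T : measurableType d) (R : realType)
    (mu : {measure set T -> \bar R}) (f g : T -> R) (M : R) :
  (forall x, `|f x| <= g x) -> (\int[mu]_x (g x)%:E <= M%:E)%E ->
  `|\int[mu]_x f x| <= M.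
Proof.
move=> fg gM; rewrite /Rintegral integralE.
set u := integral _ _ _; set v := integral _ _ _.
have bnd (h : T -> \bar R) : (forall x, 0 <= h x)%E -> (forall x, h x <= `|f x|%:E)%E ->
    exists2 r : R, integral mu setT h = r%:E & 0 <= r <= M.
  move=> h0 hf; have i0 : (0 <= integral mu setT h)%E by exact: integral_ge0.
  have iM : (integral mu setT h <= M%:E)%E.
    apply: le_trans gM; apply: ge0_le_integral_nonmeasurable => // x.
    by rewrite (le_trans (hf x))// lee_fin.
  case: (integral mu setT h) i0 iM => [r|//|//]; rewrite !lee_fin => r0 rM.
  by exists r; rewrite ?r0.
have [r ur /andP[r0 rM]] : exists2 r : R, u = r%:E & 0 <= r <= M.
  apply: bnd => x; first exact: funepos_ge0.
  by rewrite funeposE -EFin_max lee_fin ge_max ler_norm normr_ge0.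
have [q vq /andP[q0 qM]] : exists2 r : R, v = r%:E & 0 <= r <= M.
  apply: bnd => x; first exact: funeneg_ge0.
  by rewrite funenegE -EFinN -EFin_max lee_fin ge_max -normrN ler_norm normr_ge0.
by rewrite ur vq /= ler_norml; apply/andP; split; lra.
Qed.

Lemma integral_lincomb_le d (T : measurableType d) (R : realType)
    (mu : {measure set T -> \bar R}) (f g : T -> R) (a b F G : R) :
  0 <= a -> 0 <= b -> (forall x, 0 <= f x) -> (forall x, 0 <= g x) ->
  measurable_fun setT f -> measurable_fun setT g ->
  (\int[mu]_x (f x)%:E <= F%:E)%E -> (\int[mu]_x (g x)%:E <= G%:E)%E ->
  (\int[mu]_x (a * f x + b * g x)%:E <= (a * F + b * G)%:E)%E.
Proof.
move=> a0 b0 f0 g0 mf mg fF gG.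
under eq_integral do rewrite EFinD !EFinM.
rewrite ge0_integralD//; first last.
- rewrite -[X in measurable_fun _ X]/(EFin \o (fun x => b * g x)).
  by apply/measurable_EFinP; exact: measurable_funM.
- by move=> x _; rewrite -EFinM lee_fin mulr_ge0.
- rewrite -[X in measurable_fun _ X]/(EFin \o (fun x => a * f x)).
  by apply/measurable_EFinP; exact: measurable_funM.
- by move=> x _; rewrite -EFinM lee_fin mulr_ge0.
rewrite !ge0_integralZl//; try by [exact/measurable_EFinP|move=> x _; rewrite lee_fin].
by rewrite EFinD !EFinM leeD// lee_wpmul2l ?lee_fin.
Qed.

(** * The operator norm *)

Section OperatorNorm.
Context {R : realType}.

(** Coordinates of a vector in the unit ball are at most 1 in absolute value, so absolute row sums
    bound the entries of [M *m x]. This makes the [sup] in [opnorm] a genuine supremum and not a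
    default value. *)
Lemma has_ubound_opnorm k (M : 'M[R]_k) :
  has_ubound [set euclidean_norm (M *m x) | x in [set x : 'cV[R]_k | euclidean_norm x <= 1]].
Proof.
exists (Num.sqrt (\sum_i (\sum_j `|M i j|) ^+ 2)) => _ [x /= x1 <-].
have xj j : `|x j 0| <= 1.
  rewrite -(@ler_pXn2r _ 2)// ?nnegrE// expr1n real_normK ?num_real//.
  apply: (@le_trans _ _ (euclidean_norm x ^+ 2)).
    rewrite euclidean_normE (bigD1 j)//= lerDl sumr_ge0// => i _.
    exact: sqr_ge0.
  by rewrite expr_le1// euclidean_norm_ge0.
apply: ler_wsqrtr; apply: ler_sum => i _.
rewrite -real_normK ?num_real// lerXn2r// ?nnegrE ?sumr_ge0// mxE.
apply: le_trans (ler_norm_sum _ _ _) _; apply: ler_sum => j _.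
by rewrite normrM ler_piMr.
Qed.

Lemma opnorm_ub k (M : 'M[R]_k) (x : 'cV[R]_k) :
  euclidean_norm x <= 1 -> euclidean_norm (M *m x) <= opnorm M.
Proof. by move=> x1; apply: ub_le_sup; [exact: has_ubound_opnorm|exists x]. Qed.

Lemma euclidean_norm_mulmx_le k (M : 'M[R]_k) (x : 'cV[R]_k) :
  euclidean_norm (M *m x) <= opnorm M * euclidean_norm x.
Proof.
have [->|x0] := eqVneq x 0.
  have z : euclidean_norm (0 : 'cV[R]_k) = 0 by apply/eqP; rewrite euclidean_norm_eq0.
  by rewrite mulmx0 !z mulr0.
have nx0 : 0 < euclidean_norm x.
  by rewrite lt_neqAle euclidean_norm_ge0 andbT eq_sym euclidean_norm_eq0.
have := @opnorm_ub k M ((euclidean_norm x)^-1 *: x).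
rewrite -scalemxAr !euclidean_normZ gtr0_norm ?invr_gt0// mulVf ?gt_eqF//.
by move=> /(_ (lexx _)); rewrite mulrC ler_pdivrMr.
Qed.

Lemma opnorm_gt0 k (M : 'M[R]_k) : (0 < k)%N -> M \in unitmx -> 0 < opnorm M.
Proof.
case: k M => // k M _ Mu.
pose e : 'cV[R]_k.+1 := const_mx 1.
have Me0 : M *m e != 0.
  apply: contraTneq isT => /(congr1 (mulmx (invmx M))).
  rewrite mulKmx// mulmx0 => /colP/(_ 0) /eqP.
  by rewrite !mxE oner_eq0.
rewrite ltNge; apply: contra Me0 => M0.
rewrite -euclidean_norm_eq0 eq_le euclidean_norm_ge0 andbT.
by rewrite (le_trans (euclidean_norm_mulmx_le M e))// mulr_le0_ge0// euclidean_norm_ge0.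
Qed.

(** A basis vector attains the value 1; in dimension 0 there is none and the norm would be 0. *)
Lemma opnorm1 k : (0 < k)%N -> opnorm (1%:M : 'M[R]_k) = 1.
Proof.
case: k => // k _.
pose e : 'cV[R]_k.+1 := delta_mx 0 0.
have e1 : euclidean_norm e = 1.
  rewrite /euclidean_norm (bigD1 0)//= big1 => [|i i0].
    by rewrite mxE eqxx expr1n addr0 sqrtr1.
  by rewrite mxE (negbTE i0) expr0n.
apply/eqP; rewrite eq_le; apply/andP; split; last first.
  by have := @opnorm_ub k.+1 1%:M e; rewrite mul1mx e1; apply.
apply: ge_sup; first by exists (euclidean_norm (1%:M *m e)), e => //=; rewrite e1.
by move=> _ [x /= x1 <-]; rewrite mul1mx.
Qed.

End OperatorNorm.

(** * Splitting a product of two weights and integrating it *)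

(** If [p] and [q] were both below [N / 4], then [2 * p + 2 * q] would be below [N]. Whichever is
    large yields one summand, and the other summand is nonnegative. *)
Lemma exprVn_mul_le_split (R : realFieldType) (p q N : R) (m n : nat) :
  0 < p -> 0 < q -> 0 < N -> N <= 2 * p + 2 * q ->
  p ^- m * q ^- n <= 4 ^+ m * N ^- m * q ^- n + 4 ^+ n * N ^- n * p ^- m.
Proof.
move=> p0 q0 N0 Npq.
have far (y : R) j : N / 4 <= y -> y ^- j <= 4 ^+ j * N ^- j.
  move=> Ny; have -> : 4 ^+ j * N ^- j = (N / 4) ^- j by rewrite exprMn exprVn invfM invrK mulrC.
  have N40 : 0 < N / 4 by rewrite divr_gt0.
  have y0 := lt_le_trans N40 Ny.
  by rewrite lef_pV2 ?posrE ?exprn_gt0// lerXn2r// ?nnegrE ltW.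
have i0 (y : R) j : 0 < y -> 0 <= y ^- j by move=> y0; rewrite invr_ge0 exprn_ge0// ltW.
have [Np|Np] := leP (N / 4) p.
  by rewrite (le_trans (ler_wpM2r (i0 q n q0) (far _ m Np)))// lerDl !mulr_ge0// i0.
have Nq : N / 4 <= q by lra.
rewrite mulrC (le_trans (ler_wpM2r (i0 p m p0) (far _ n Nq)))// lerDr.
by rewrite !mulr_ge0// i0.
Qed.

(* [2 K^2 P + 2 Q] dominates [N] for [P = |A (x - a)|^2 + c^2] and
   [Q = |B (x - b)|^2 + d^2], so at every point one of the two factors is
   controlled by a power of [N] and the other one is integrated. *)
Lemma normr_Rintegral_product_le (R : realType) (k m n : nat) (c0 C0 c d : R)
    (a b : 'cV[R]_k) (A B : 'M[R]_k) (h : k.-tuple (measurableTypeR R) -> R) :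
  (0 < k)%N -> (k < 2 * m)%N -> (k < 2 * n)%N ->
  0 < c0 -> c0 <= c -> c0 <= d -> 0 <= C0 -> A \in unitmx -> B \in unitmx ->
  (forall x, `|h x| <= C0 *
    ((euclidean_norm (A *m (tuple_col x - a)) ^+ 2 + c ^+ 2) ^- m *
     (euclidean_norm (B *m (tuple_col x - b)) ^+ 2 + d ^+ 2) ^- n)) ->
  `|\int[lebesgue_tuple R k]_x h x| <=
  C0 * (4 ^+ m + 4 ^+ n) * pi ^+ k / c0 * conv_bound m n c d a (- b) A B 0.
Proof.
move=> k0 km kn c00 cc0 dc0 C00 Au Bu hP.
rewrite /conv_bound addr0; set K := opnorm _; set N := _ + _ + K ^+ 2 * _.
have cgt0 : 0 < c := lt_le_trans c00 cc0.
have dgt0 : 0 < d := lt_le_trans c00 dc0.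
have K0 : 0 < K by rewrite opnorm_gt0// unitmx_mul Bu unitmx_inv.
have Kc0 : 0 < K * c by rewrite mulr_gt0.
have N0 : 0 < N by rewrite addr_gt0 ?mulr_gt0 ?exprn_gt0// ltr_wpDl ?sqr_ge0 ?exprn_gt0.
have detB0 : 0 < `|\det B| by rewrite normr_gt0 -unitfE -unitmxE.
(* The factor with [A] and [c] is replaced by one with [B] and [K * c], so that both integrals
   produce the same [|\det B|]. *)
pose wp := affine_weight B (- (B *m a)) (K * c) (2 * m).
pose wq := affine_weight B (- (B *m b)) d (2 * n).
have bound : `|\int[lebesgue_tuple R k]_x h x| <=
    C0 * K ^+ (2 * m) * 4 ^+ m * N ^- m * (pi ^+ k / `|\det B| * d ^- (2 * n - k)) +
    C0 * K ^+ (2 * m) * 4 ^+ n * N ^- n * (pi ^+ k / `|\det B| * (K * c) ^- (2 * m - k)).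
  apply: (@normr_Rintegral_le _ _ _ _ _ (fun x =>
      C0 * K ^+ (2 * m) * 4 ^+ m * N ^- m * wq x +
      C0 * K ^+ (2 * m) * 4 ^+ n * N ^- n * wp x)); last first.
    apply: integral_lincomb_le.
    - by rewrite !mulr_ge0 ?invr_ge0 ?exprn_ge0// ltW.
    - by rewrite !mulr_ge0 ?invr_ge0 ?exprn_ge0// ltW.
    - by move=> x; exact: affine_weight_ge0.
    - by move=> x; exact: affine_weight_ge0.
    - exact: measurable_affine_weight.
    - exact: measurable_affine_weight.
    - exact: integral_square_affine_weight_le.
    - exact: integral_square_affine_weight_le.
  move=> x; apply: le_trans (hP x) _.
  rewrite /wp /wq !affine_weight_double -!mulmxBr.
  set y := tuple_col x.
  set P := _ + c ^+ 2; set Q := _ + d ^+ 2; set p := _ + (K * c) ^+ 2.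
  have Q0 : 0 < Q by rewrite ltr_wpDl ?sqr_ge0 ?exprn_gt0.
  have p0 : 0 < p by rewrite ltr_wpDl ?sqr_ge0 ?exprn_gt0.
  have P0 : 0 < P by rewrite ltr_wpDl ?sqr_ge0 ?exprn_gt0.
  (* This is [|B z| = |B A^-1 (A z)| <= K |A z|] for [z = y - a]. *)
  have pP : p <= K ^+ 2 * P.
    rewrite mulrDr -!exprMn lerD2r lerXn2r ?nnegrE ?mulr_ge0 ?euclidean_norm_ge0 ?(ltW K0)//.
    rewrite -[in leLHS](mulKmx Au (y - a)) [B *m _]mulmxA.
    exact: euclidean_norm_mulmx_le.
  have Npq : N <= 2 * p + 2 * Q.
    have -> : 2 * p + 2 * Q = 2 * euclidean_norm (B *m (y - a)) ^+ 2 +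
        2 * euclidean_norm (B *m (y - b)) ^+ 2 + 2 * (K * c) ^+ 2 + 2 * d ^+ 2.
      by rewrite /p /Q; ring.
    have := euclidean_normD_sqr_le (B *m (y - b)) (- (B *m (y - a))).
    have yab : y - b - (y - a) = a - b by apply/colP => i; rewrite !mxE; ring.
    rewrite euclidean_normN -mulmxBr yab /N -exprMn => ?.
    have := sqr_ge0 (K * c); have := sqr_ge0 d; lra.
  have PK : P ^- m <= K ^+ (2 * m) * p ^- m.
    have -> : K ^+ (2 * m) * p ^- m = (p / K ^+ 2) ^- m.
      by rewrite exprMn exprVn -exprM invfM invrK mulrC.
    rewrite lef_pV2 ?posrE ?exprn_gt0 ?divr_gt0 ?exprn_gt0//.
    have pKP : p / K ^+ 2 <= P by rewrite ler_pdivrMr ?exprn_gt0// mulrC.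
    by rewrite lerXn2r// nnegrE ltW// divr_gt0 ?exprn_gt0.
  have split := exprVn_mul_le_split m n p0 Q0 N0 Npq.
  have -> : C0 * K ^+ (2 * m) * 4 ^+ m * N ^- m * Q ^- n +
      C0 * K ^+ (2 * m) * 4 ^+ n * N ^- n * p ^- m =
      C0 * (K ^+ (2 * m) * (4 ^+ m * N ^- m * Q ^- n + 4 ^+ n * N ^- n * p ^- m)) by ring.
  apply: ler_wpM2l => //.
  apply: le_trans (_ : K ^+ (2 * m) * (p ^- m * Q ^- n) <= _).
    by rewrite mulrA ler_wpM2r// invr_ge0 exprn_ge0 ?ltW.
  by rewrite ler_wpM2l// exprn_ge0 ?ltW.
apply: le_trans bound _.
(* [k < j] makes [j - k] a successor, so subtracting one more is genuine; the extra [e^-1] is at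
   most [c0^-1]. *)
have drop (e : R) j : c0 <= e -> (k < j)%N -> e ^- (j - k) <= c0^-1 * e ^- (j - k - 1).
  move=> ce kj; have e0 := lt_le_trans c00 ce.
  have -> : (j - k = (j - k - 1).+1)%N by lia.
  have eV : e^-1 <= c0^-1 by rewrite lef_pV2 ?posrE.
  by rewrite exprS invfM subSS subn0 ler_wpM2r// invr_ge0 exprn_ge0// ltW.
(* The integral of [wp] gives back [2 * m - k] of the [2 * m] powers of [K], which explains the
   [K ^+ k] in the first term of [conv_bound]. *)
have Kk : K ^+ (2 * m) * (K * c) ^- (2 * m - k) = K ^+ k * c ^- (2 * m - k).
  rewrite exprMn invfM mulrA; congr (_ * _).
  by rewrite -{1}(subnK (ltnW km)) exprD [X in X / _]mulrC mulfK// expf_neq0 ?gt_eqF.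
set Ic := (c ^+ (2 * m - k - 1))^-1; set Id := (d ^+ (2 * n - k - 1))^-1.
have dropc : c ^- (2 * m - k) <= c0^-1 * Ic by exact: drop.
have dropd : d ^- (2 * n - k) <= c0^-1 * Id by exact: drop.
have Ic0 : 0 <= Ic by rewrite invr_ge0 exprn_ge0 ?ltW.
have Id0 : 0 <= Id by rewrite invr_ge0 exprn_ge0 ?ltW.
set U := pi ^+ k / `|\det B|.
have U0 : 0 <= U by rewrite divr_ge0 ?exprn_ge0 ?pi_ge0.
have f4 j : 0 <= 4 ^+ j :> R by rewrite exprn_ge0.
have NV j : 0 <= N ^- j by rewrite invr_ge0 exprn_ge0 ?ltW.
have KX j : 0 <= K ^+ j by rewrite exprn_ge0 ?ltW.
have cV0 : 0 <= c ^- (2 * m - k) by rewrite invr_ge0 exprn_ge0 ?ltW.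
have dV0 : 0 <= d ^- (2 * n - k) by rewrite invr_ge0 exprn_ge0 ?ltW.
have c0V : 0 <= c0^-1 by rewrite invr_ge0 ltW.
(* Both [4 ^+ m] and [4 ^+ n] are enlarged to their sum, which keeps the constant symmetric in [m]
   and [n] for the dual bound. *)
have -> : C0 * (4 ^+ m + 4 ^+ n) * pi ^+ k / c0 * (`|\det B|^-1 *
    (K ^+ k / N ^+ n * Ic + K ^+ (2 * m) / N ^+ m * Id)) =
  C0 * K ^+ (2 * m) * N ^- m * U * (c0^-1 * Id) * (4 ^+ m + 4 ^+ n) +
  C0 * K ^+ k * N ^- n * U * (c0^-1 * Ic) * (4 ^+ m + 4 ^+ n).
  by rewrite /U; ring.
clearbody U Ic Id.
have -> : C0 * K ^+ (2 * m) * 4 ^+ n * N ^- n * (U * (K * c) ^- (2 * m - k)) =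
    C0 * N ^- n * U * 4 ^+ n * (K ^+ (2 * m) * (K * c) ^- (2 * m - k)) by ring.
rewrite Kk; apply: lerD.
- have -> : C0 * K ^+ (2 * m) * 4 ^+ m * N ^- m * (U * d ^- (2 * n - k)) =
    C0 * K ^+ (2 * m) * N ^- m * U * d ^- (2 * n - k) * 4 ^+ m by ring.
  apply: ler_pM => //; rewrite ?lerDl//.
    by rewrite !mulr_ge0.
  by rewrite ler_wpM2l// !mulr_ge0.
- have -> : C0 * N ^- n * U * 4 ^+ n * (K ^+ k * c ^- (2 * m - k)) =
    C0 * K ^+ k * N ^- n * U * c ^- (2 * m - k) * 4 ^+ n by ring.
  apply: ler_pM => //; rewrite ?lerDr//.
    by rewrite !mulr_ge0.
  by rewrite ler_wpM2l// !mulr_ge0.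
Qed.

(** * From real integrands to complex convolutions *)

Lemma normr_Re_le (R : realType) (z : R[i]) : `|complex.Re z| <= cabs z.
Proof. by case: z => x y; rewrite /cabs /= -sqrtr_sqr ler_wsqrtr// lerDl sqr_ge0. Qed.

Lemma normr_Im_le (R : realType) (z : R[i]) : `|complex.Im z| <= cabs z.
Proof. by case: z => x y; rewrite /cabs /= -sqrtr_sqr ler_wsqrtr// lerDr sqr_ge0. Qed.

Lemma cabs_le_ReD_Im (R : realType) (x y : R) :
  cabs (Complex x y) <= `|x| + `|y|.
Proof.
rewrite /cabs /= -[leRHS]ger0_norm ?addr_ge0// -sqrtr_sqr ler_wsqrtr//.
rewrite sqrrD !real_normK ?num_real// -addrA lerD2l lerDr.
by rewrite mulrn_wge0// mulr_ge0.
Qed.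

Lemma conv_bound_id (R : realType) (k m n : nat) (c d : R) (t : 'cV[R]_k) :
  (0 < k)%N ->
  conv_bound m n c d 0 0 1%:M 1%:M t =
  ((euclidean_norm t ^+ 2 + c ^+ 2 + d ^+ 2) ^+ n)^-1 * (c ^+ (2 * m - k - 1))^-1 +
  ((euclidean_norm t ^+ 2 + c ^+ 2 + d ^+ 2) ^+ m)^-1 * (d ^+ (2 * n - k - 1))^-1.
Proof.
move=> k0; rewrite /conv_bound invmx1 mulmx1 opnorm1// !addr0 add0r mul1mx.
by rewrite det1 normr1 invr1 !expr1n !mul1r addrAC.
Qed.

(** The constant is fixed before the matrices, shifts and functions. Integration yields
    [c ^- (2 * m - k)], one power more than the bound displays; the lower bound [c0] on [c] and [d]
    lets [C] absorb it uniformly. *)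
Theorem corollary6p4 (R : realType) (k m n : nat) (c0 Cf Cg : R) :
  (0 < k)%N -> (uphalf k < m)%N -> (uphalf k < n)%N ->
  0 < c0 -> 0 < Cf -> 0 < Cg ->
  exists2 C : R, 0 < C &
    forall (c d : R) (r s : 'cV[R]_k) (A B : 'M[R]_k) (f g : 'cV[R]_k -> R[i]),
      c0 <= c -> c0 <= d ->
      A \in unitmx -> B \in unitmx -> cdiagonalizable (A *m invmx B) ->
      (forall x, cabs (f x) <= Cf * (euclidean_norm (A *m (x + r)) ^+ 2 + c ^+ 2) ^- m) ->
      (forall x, cabs (g x) <= Cg * (euclidean_norm (B *m (x + s)) ^+ 2 + d ^+ 2) ^- n) ->
      [/\ forall t, cabs (convolution f g t) <= C * conv_bound m n c d r s A B t,
          forall t, cabs (convolution f g t) <= C * conv_bound n m d c s r B A t,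
          forall t, cabs (convolution f g t) <=
            C * Num.min (conv_bound m n c d r s A B t) (conv_bound n m d c s r B A t)
        & A = 1%:M -> B = 1%:M -> r = 0 -> s = 0 ->
          forall t, cabs (convolution f g t) <=
            C * (((euclidean_norm t ^+ 2 + c ^+ 2 + d ^+ 2) ^+ n)^-1 * (c ^+ (2 * m - k - 1))^-1 +
                 ((euclidean_norm t ^+ 2 + c ^+ 2 + d ^+ 2) ^+ m)^-1 * (d ^+ (2 * n - k - 1))^-1)].
Proof.
move=> k0 km kn c00 Cf0 Cg0.
have k2m : (k < 2 * m)%N by lia.
have k2n : (k < 2 * n)%N by lia.
pose C1 := Cf * Cg * (4 ^+ m + 4 ^+ n) * pi ^+ k / c0.
have C10 : 0 < C1 by rewrite !mulr_gt0 ?invr_gt0 ?addr_gt0 ?exprn_gt0// pi_gt0.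
(* The factor 2 pays for estimating the real and imaginary parts separately. *)
exists (2 * C1); first by rewrite mulr_gt0.
move=> c d r s A B f g cc0 dc0 Au Bu _ fP gP.
pose P t x := (euclidean_norm (A *m (x - (t + r))) ^+ 2 + c ^+ 2) ^- m.
pose Q x := (euclidean_norm (B *m (x - (- s))) ^+ 2 + d ^+ 2) ^- n.
have fgP t x : cabs (f (t - x) * g x) <= Cf * Cg * (P t x * Q x).
  rewrite /cabs ComplexField.Normc.normcM mulrACA ler_pM ?sqrtr_ge0//.
  - by case: (f _) => ? ?; exact: sqrtr_ge0.
  - by case: (g _) => ? ?; exact: sqrtr_ge0.
  - rewrite /P -(euclidean_normN (A *m _)) -mulmxN.
    have -> : - (x - (t + r)) = t - x + r by rewrite opprB addrAC.
    exact: fP.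
  - by rewrite /Q opprK; exact: gP.
have cabs_conv t (M : R) :
    (forall h : k.-tuple (measurableTypeR R) -> R,
      (forall x, `|h x| <= Cf * Cg * (P t (tuple_col x) * Q (tuple_col x))) ->
      `|\int[lebesgue_tuple R k]_x h x| <= C1 * M) ->
    cabs (convolution f g t) <= 2 * C1 * M.
  move=> hM; apply: le_trans (cabs_le_ReD_Im _ _) _.
  rewrite -mulrA mulr_natl mulr2n; apply: lerD; apply: hM => x.
    exact: le_trans (normr_Re_le _) (fgP _ _).
  exact: le_trans (normr_Im_le _) (fgP _ _).
have bound1 t : cabs (convolution f g t) <= 2 * C1 * conv_bound m n c d r s A B t.
  apply: cabs_conv => h hP.
  (* The translation [t] is absorbed into the centre [t + r] of the first weight; the second is
     centred at [- s]. *)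
  have -> : conv_bound m n c d r s A B t = conv_bound m n c d (t + r) (- - s) A B 0.
    have rst : r + s + t = t + r - - s by rewrite opprK addrC addrA.
    by rewrite /conv_bound addr0 rst.
  by apply: normr_Rintegral_product_le; rewrite // mulr_ge0 ?ltW.
have bound2 t : cabs (convolution f g t) <= 2 * C1 * conv_bound n m d c s r B A t.
  apply: cabs_conv => h hP.
  (* The pointwise majorant is symmetric in its two factors, so the same estimate applies with them
     exchanged. The difference of the centres changes sign, which the norm ignores. *)
  have -> : conv_bound n m d c s r B A t = conv_bound n m d c (- s) (- (t + r)) B A 0.
    have srt : s + r + t = - (- s - (t + r)) by rewrite opprB opprK addrC [s + r]addrC addrA.
    by rewrite /conv_bound addr0 srt mulmxN euclidean_normN.
  rewrite /C1 [4 ^+ m + _]addrC.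
  apply: normr_Rintegral_product_le => //; first by rewrite mulr_ge0 ?ltW.
  by move=> x; rewrite [X in _ * X]mulrC; exact: hP.
split => //.
  have C20 : 0 <= 2 * C1 by rewrite mulr_ge0// ltW.
  by move=> t; rewrite minr_pMr// le_min bound1 bound2.
by move=> A1 B1 r0 s0 t; rewrite -conv_bound_id// -{1}A1 -{1}B1 -{1}r0 -{1}s0.
Qed.
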